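(* Assume that $A_{\mathrm{ext}}$ generates a contractive $C_0$-semigroup on $H_1 \times H_2$. Any of the following two assumptions implies that $A_S$ is strictly dissipative (and thus that the semigroup $(e^{tA_S})_{t \ge 0}$ is exponentially stable): (1) There exists $\varepsilon > 0$ such that $\operatorname{Re}(A_{\mathrm{ext}} h | h) \le -\varepsilon \|h_1\|_{H_1}^2$ for all $h = (h_1,h_2) \in \operatorname{dom}(A_{\mathrm{ext}})$. (2) The operator $A_{21}$ is bounded below, i.e., there exists a constant $c > 0$ such that $\|A_{21} h_1\|_{H_2} \ge c \|h_1\|_{H_1}$ for all $h_1 \in \operatorname{dom}(A_{21})$.
   Context: Inner products on complex Hilbert spaces are linear in the first and antilinear in the second component. Let $H_1, H_2$ be non-zero complex Hilbert spaces, let $A_1: \operatorname{dom}(A_1) \subseteq H_1 \times H_2 \to H_1$ and $A_{21}: \operatorname{dom}(A_{21}) \subseteq H_1 \to H_2$ be linear operators (defined on vector subspaces), and let $S: H_2 \to H_2$ be a bounded linear operator that is coercive: there is $\nu > 0$ with $\operatorname{Re}(h_2 | S h_2)_{H_2} \ge \nu \|h_2\|_{H_2}^2$ for all $h_2 \in H_2$. The operator $A_{\mathrm{ext}}$ on $H_1 \times H_2$ has domain $\operatorname{dom}(A_{\mathrm{ext}}) = \{ (h_1,h_2) \in \operatorname{dom}(A_1) : h_1 \in \operatorname{dom}(A_{21}) \}$ and acts as $A_{\mathrm{ext}}(h_1,h_2) = (A_1(h_1,h_2),\, A_{21}h_1)$. The operator $A_S$ on $H_1$ has domain $\operatorname{dom}(A_S)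 = \{ h_1 \in \operatorname{dom}(A_{21}) : (h_1, S A_{21} h_1) \in \operatorname{dom}(A_1) \}$ and acts as $A_S h_1 = A_1 (h_1, S A_{21} h_1)$. (Known theorem of Zwart, Le Gorrec and Maschke: if $A_{\mathrm{ext}}$ generates a contractive $C_0$-semigroup on $H_1\times H_2$, then $A_S$ generates a contractive $C_0$-semigroup $(e^{tA_S})_{t\ge 0}$ on $H_1$.) A linear operator $A$ on a complex Hilbert space $H$ is strictly dissipative if there is $\varepsilon>0$ with $\operatorname{Re}(Ah|h) \le -\varepsilon\|h\|^2$ for all $h \in \operatorname{dom}(A)$. A $C_0$-semigroup is exponentially stable if it converges to $0$ with respect to the operator norm as $t \to \infty$. *)

(* Defs.v *)
From Stdlib Require Import Reals Lra Psatz.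
From Coquelicot Require Import Coquelicot.
Open Scope R_scope.

(** The norm of the underlying [CompleteNormedModule] is the one induced by the
    inner product ([inner_norm]); with [norm_eq_zero] this also yields
    definiteness. *)
Record Hilbert := mkHilbert {
  Hilbert_space :> CompleteNormedModule C_AbsRing;
  inner : Hilbert_space -> Hilbert_space -> C;
  inner_plus_l : forall x y z,
    inner (plus x y) z = Cplus (inner x z) (inner y z);
  inner_scal_l : forall (a : C) x y,
    inner (scal a x) y = Cmult a (inner x y);
  inner_conj : forall x y, inner y x = Cconj (inner x y);
  inner_norm : forall x, inner x x = RtoC (norm x ^ 2)
}.

Arguments inner {h} _ _.

(** Coquelicot's norm on a product is [sqrt (norm (fst x) ^ 2 + norm (snd x) ^ 2)],
    which is the Hilbert norm of the direct sum; only completeness is missing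
    from the library. *)
Section Product.

Variables U V : CompleteNormedModule C_AbsRing.

Definition prod_lim (F : (U * V -> Prop) -> Prop) : U * V :=
  (lim (filtermap fst F), lim (filtermap snd F)).

Lemma prod_complete_cauchy (F : (U * V -> Prop) -> Prop) :
  ProperFilter F -> cauchy F -> forall eps : posreal, F (ball (prod_lim F) eps).
Proof.
intros PF cF eps.
assert (H1 : F (fun z => ball (lim (filtermap fst F)) eps (fst z))).
{ apply (complete_cauchy (filtermap fst F)).
  - apply filtermap_proper_filter; exact PF.
  - intros e; destruct (cF e) as [x Hx]; exists (fst x).
    unfold filtermap; revert Hx; apply filter_imp; intros z Hz; apply Hz. }
assert (H2 : F (fun z => ball (lim (filtermap snd F)) eps (snd z))).
{ apply (complete_cauchy (filtermap snd F)).
  - apply filtermap_proper_filter; exact PF.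
  - intros e; destruct (cF e) as [x Hx]; exists (snd x).
    unfold filtermap; revert Hx; apply filter_imp; intros z Hz; apply Hz. }
generalize (filter_and _ _ H1 H2); apply filter_imp.
intros z [Hz1 Hz2]; split; assumption.
Qed.

Lemma prod_close_lim (F1 F2 : (U * V -> Prop) -> Prop) :
  filter_le F1 F2 -> filter_le F2 F1 -> close (prod_lim F1) (prod_lim F2).
Proof.
intros H12 H21 eps; split; simpl.
- apply (close_lim (filtermap fst F1) (filtermap fst F2)).
  + intros P HP; apply H12; exact HP.
  + intros P HP; apply H21; exact HP.
- apply (close_lim (filtermap snd F1) (filtermap snd F2)).
  + intros P HP; apply H12; exact HP.
  + intros P HP; apply H21; exact HP.
Qed.

Definition prod_CompleteNormedModule : CompleteNormedModule C_AbsRing :=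
  CompleteNormedModule.Pack C_AbsRing (U * V)
    (CompleteNormedModule.Class C_AbsRing (U * V)
      (NormedModule.class C_AbsRing (prod_NormedModule C_AbsRing U V))
      (CompleteSpace.Mixin (prod_UniformSpace U V)
        prod_lim prod_complete_cauchy prod_close_lim))
    (U * V).

End Product.

Section HilbertProduct.

Variables H1 H2 : Hilbert.

Let P := prod_CompleteNormedModule H1 H2.

Definition prod_inner (x y : P) : C :=
  Cplus (inner (fst x) (fst y)) (inner (snd x) (snd y)).

Lemma prod_inner_plus_l (x y z : P) :
  prod_inner (plus x y) z = Cplus (prod_inner x z) (prod_inner y z).
Proof.
destruct x as [x1 x2], y as [y1 y2]; unfold prod_inner; simpl.
rewrite !inner_plus_l; ring.
Qed.

Lemma prod_inner_scal_l (a : C) (x y : P) :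
  prod_inner (scal a x) y = Cmult a (prod_inner x y).
Proof.
destruct x as [x1 x2]; unfold prod_inner; simpl.
rewrite !inner_scal_l; ring.
Qed.

Lemma prod_inner_conj (x y : P) : prod_inner y x = Cconj (prod_inner x y).
Proof.
unfold prod_inner; rewrite Cplus_conj, <- !inner_conj; reflexivity.
Qed.

Lemma prod_inner_norm (x : P) : prod_inner x x = RtoC (norm x ^ 2).
Proof.
unfold prod_inner; rewrite !inner_norm, <- RtoC_plus; f_equal.
change (norm x) with (sqrt (norm (fst x) ^ 2 + norm (snd x) ^ 2)).
rewrite pow2_sqrt; [reflexivity | nra].
Qed.

Definition prod_Hilbert : Hilbert :=
  mkHilbert P prod_inner prod_inner_plus_l prod_inner_scal_l
    prod_inner_conj prod_inner_norm.

End HilbertProduct.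

(** An operator is represented by its domain and a total function; the values of
    that function outside the domain are irrelevant. *)
Record Operator (X Y : Hilbert) := mkOperator {
  dom : X -> Prop;
  op :> X -> Y;
  dom_zero : dom zero;
  dom_plus : forall x y, dom x -> dom y -> dom (plus x y);
  dom_scal : forall (a : C) x, dom x -> dom (scal a x);
  op_plus : forall x y, dom x -> dom y -> op (plus x y) = plus (op x) (op y);
  op_scal : forall (a : C) x, dom x -> op (scal a x) = scal a (op x)
}.

Arguments mkOperator {X Y} _ _ _ _ _ _ _.
Arguments dom {X Y} _ _.
Arguments op {X Y} _ _.
Arguments dom_zero {X Y} _.
Arguments dom_plus {X Y} _ _ _ _ _.
Arguments dom_scal {X Y} _ _ _ _.
Arguments op_plus {X Y} _ _ _ _ _.
Arguments op_scal {X Y} _ _ _ _.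

Definition strictly_dissipative {X : Hilbert} (A : Operator X X) : Prop :=
  exists eps : R, 0 < eps /\
    forall x, dom A x -> Re (inner (A x) x) <= - eps * norm x ^ 2.

(** Applied to maps [S] with [is_linear S], which in Coquelicot includes boundedness. *)
Definition coercive {X : Hilbert} (S : X -> X) : Prop :=
  exists nu : R, 0 < nu /\ forall x, nu * norm x ^ 2 <= Re (inner x (S x)).

Definition bounded_below {X Y : Hilbert} (A : Operator X Y) : Prop :=
  exists c : R, 0 < c /\ forall x, dom A x -> c * norm x <= norm (A x).

(** Only the values [T t] with [0 <= t] are constrained. *)
Record C0_semigroup {X : Hilbert} (T : R -> X -> X) : Prop := mkC0_semigroup {
  semigroup_linear : forall t, 0 <= t -> is_linear (T t);
  semigroup_zero : forall x, T 0 x = x;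
  semigroup_plus : forall s t x, 0 <= s -> 0 <= t -> T (s + t) x = T s (T t x);
  semigroup_cont : forall x, filterlim (fun t => T t x) (at_right 0) (locally x)
}.

Definition contractive {X : Hilbert} (T : R -> X -> X) : Prop :=
  forall t x, 0 <= t -> norm (T t x) <= norm x.

(** The equivalence forces [dom A] to be maximal: all [x] for which the limit exists. *)
Definition is_generator {X : Hilbert} (A : Operator X X) (T : R -> X -> X) : Prop :=
  forall x y, (dom A x /\ A x = y) <->
    filterlim (fun t => scal (RtoC (/ t)) (minus (T t x) x)) (at_right 0) (locally y).

Definition generates_contraction_semigroup {X : Hilbert} (A : Operator X X) : Prop :=
  exists T, C0_semigroup T /\ contractive T /\ is_generator A T.

(** The supremum is finite when [B] is linear and bounded. *)
Definition op_norm {X Y : Hilbert} (B : X -> Y) : R :=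
  real (Lub_Rbar (fun r => exists x, norm x <= 1 /\ r = norm (B x))).

Definition exponentially_stable {X : Hilbert} (T : R -> X -> X) : Prop :=
  is_lim (fun t => op_norm (T t)) p_infty 0.

Section Operators.

Variables H1 H2 : Hilbert.
Variable A1 : Operator (prod_Hilbert H1 H2) H1.
Variable A21 : Operator H1 H2.

Definition A_ext : Operator (prod_Hilbert H1 H2) (prod_Hilbert H1 H2).
Proof.
refine (@mkOperator (prod_Hilbert H1 H2) (prod_Hilbert H1 H2)
  (fun h => dom A1 h /\ dom A21 (fst h))
  (fun h => (A1 h, A21 (fst h))) _ _ _ _ _).
- split; [exact (dom_zero A1) | exact (dom_zero A21)].
- intros x y [Hx1 Hx2] [Hy1 Hy2]; split.
  + exact (dom_plus A1 _ _ Hx1 Hy1).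
  + exact (dom_plus A21 _ _ Hx2 Hy2).
- intros a x [Hx1 Hx2]; split.
  + exact (dom_scal A1 _ _ Hx1).
  + exact (dom_scal A21 _ _ Hx2).
- intros x y [Hx1 Hx2] [Hy1 Hy2].
  exact (f_equal2 pair (op_plus A1 _ _ Hx1 Hy1) (op_plus A21 _ _ Hx2 Hy2)).
- intros a x [Hx1 Hx2].
  exact (f_equal2 pair (op_scal A1 a _ Hx1) (op_scal A21 a _ Hx2)).
Defined.

Variable S : H2 -> H2.
Hypothesis HS : is_linear S.

Lemma S_A21_plus (x y : H1) : dom A21 x -> dom A21 y ->
  (plus x y, S (A21 (plus x y))) =
  plus ((x, S (A21 x)) : prod_Hilbert H1 H2) (y, S (A21 y)).
Proof.
intros Hx Hy; rewrite (op_plus A21 _ _ Hx Hy), (linear_plus _ HS); reflexivity.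
Qed.

Lemma S_A21_scal (a : C) (x : H1) : dom A21 x ->
  (scal a x, S (A21 (scal a x))) =
  scal a ((x, S (A21 x)) : prod_Hilbert H1 H2).
Proof.
intros Hx; rewrite (op_scal A21 _ _ Hx), (linear_scal _ HS); reflexivity.
Qed.

Lemma S_A21_zero : (zero, S (A21 zero)) = (zero : prod_Hilbert H1 H2).
Proof.
rewrite <- (scal_zero_l (zero : H1)) at 2.
rewrite (op_scal A21 _ _ (dom_zero A21)), scal_zero_l.
rewrite <- (scal_zero_l (zero : H2)) at 1.
rewrite (linear_scal _ HS), scal_zero_l; reflexivity.
Qed.

Definition A_S : Operator H1 H1.
Proof.
refine (@mkOperator H1 H1
  (fun h1 => dom A21 h1 /\ dom A1 (h1, S (A21 h1)))
  (fun h1 => A1 (h1, S (A21 h1))) _ _ _ _ _).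
- split; [exact (dom_zero A21) | exact (eq_ind_r (dom A1) (dom_zero A1) S_A21_zero)].
- intros x y [Hx1 Hx2] [Hy1 Hy2]; split.
  + exact (dom_plus A21 _ _ Hx1 Hy1).
  + exact (eq_ind_r (dom A1) (dom_plus A1 _ _ Hx2 Hy2) (S_A21_plus x y Hx1 Hy1)).
- intros a x [Hx1 Hx2]; split.
  + exact (dom_scal A21 _ _ Hx1).
  + exact (eq_ind_r (dom A1) (dom_scal A1 a _ Hx2) (S_A21_scal a x Hx1)).
- intros x y [Hx1 Hx2] [Hy1 Hy2].
  exact (eq_trans (f_equal A1 (S_A21_plus x y Hx1 Hy1)) (op_plus A1 _ _ Hx2 Hy2)).
- intros a x [Hx1 Hx2].
  exact (eq_trans (f_equal A1 (S_A21_scal a x Hx1)) (op_scal A1 a _ Hx2)).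
Defined.

End Operators.

Arguments A_ext {H1 H2} A1 A21.
Arguments A_S {H1 H2} A1 A21 {S} HS.

(* Main.v *)
Require Import Defs.
From Stdlib Require Import Reals Lra Lia Psatz Classical ClassicalEpsilon.
From Coquelicot Require Import Coquelicot.
Open Scope R_scope.

(** For [h1] in the domain of [A_S], the vector [h = (h1, S (A21 h1))] lies in the
    domain of [A_ext], and
    [Re (A_ext h | h) = Re (A_S h1 | h1) + Re (A21 h1 | S (A21 h1))].
    Coercivity makes the last term at least [nu * |A21 h1|^2]. Under (1) the left
    side is at most [- eps * |h1|^2] and the last term is nonnegative; under (2) the
    left side is at most [0], because the generator of a contraction semigroup is
    dissipative ([contraction_generator_dissipative]), and the last term is at least
    [nu * c^2 * |h1|^2]. In both cases [A_S] is strictly dissipative.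

    Stability holds for every C0-semigroup [T] with a strictly dissipative generator
    [A] ([strictly_dissipative_stable]), by a comparison with the implicit Euler
    scheme. Strict dissipativity gives [(1 + eps * h) |y| <= |y - h A y|]
    ([dissipative_resolvent]). On an orbit starting in the domain of [A], the vector
    [y = T (s + h) x] satisfies [y - h A y = T s x + o(h)] uniformly for bounded [s],
    so [(1 + eps * h) |T (s + h) x| <= |T s x| + o(h)]. After [n] steps of length
    [t / n], Bernoulli's inequality yields [(1 + eps * t) |T t x| <= |x|]
    ([dissipative_decay_dom]). This rate is only algebraic, but it already forces the
    operator norms to tend to [0], which is how stability is defined.

    Two classical facts make this rigorous for a semigroup of which only strong right
    continuity at [0] is assumed. The uniformity in [s] needs [T] to be bounded on
    bounded time intervals, which is a consequence of the uniform boundedness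
    principle ([uniform_boundedness], proved with nested balls). The passage from the
    domain to the whole space needs its density ([generator_dom_dense]): the averages
    of an orbit over [[0, a]] belong to the domain and converge to the starting point
    as [a] tends to [0]. *)

(** * Real scalars and limits in normed modules *)

Definition realification_module (X : CompleteNormedModule C_AbsRing) :
    ModuleSpace.mixin_of R_AbsRing X.
Proof.
refine (ModuleSpace.Mixin R_AbsRing X
    (fun r x => scal (RtoC r : C_AbsRing) (x : X)) _ _ _ _).
- intros r s x; rewrite scal_assoc; f_equal.
  exact (eq_sym (RtoC_mult r s)).
- intros x; exact (scal_one (x : X)).
- intros r x y; exact (scal_distr_l (RtoC r : C_AbsRing) (x : X) y).
- intros r s x.
  refine (eq_trans _ (scal_distr_r (RtoC r : C_AbsRing) (RtoC s) (x : X))).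
  f_equal; exact (RtoC_plus r s).
Defined.

Definition realification_aux (X : CompleteNormedModule C_AbsRing) :
    NormedModuleAux R_AbsRing :=
  NormedModuleAux.Pack R_AbsRing X
    (NormedModuleAux.Class R_AbsRing X
      (ModuleSpace.Class R_AbsRing X (AbelianGroup.class X)
        (realification_module X))
      (UniformSpace.class X)) X.

Definition realification_normed (X : CompleteNormedModule C_AbsRing) :
    NormedModule.mixin_of R_AbsRing (realification_aux X).
Proof.
refine (NormedModule.Mixin R_AbsRing (realification_aux X)
  (fun x => norm (x : X)) (@norm_factor C_AbsRing X)
  _ _ _ _ _).
- intros x y; exact (norm_triangle (x : X) y).
- intros r x; change (abs r) with (Rabs r); rewrite <- Cmod_R.
  exact (norm_scal (RtoC r : C_AbsRing) (x : X)).
- exact (@norm_compat1 C_AbsRing X).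
- exact (@norm_compat2 C_AbsRing X).
- exact (@norm_eq_zero C_AbsRing X).
Defined.

(** The Riemann integral is defined for modules over the reals. The carrier, the
    uniform structure and the norm are kept literally, so that statements about one
    structure are convertible to statements about the other. *)
Definition realification (X : CompleteNormedModule C_AbsRing) :
    CompleteNormedModule R_AbsRing :=
  CompleteNormedModule.Pack R_AbsRing X
    (CompleteNormedModule.Class R_AbsRing X
      (NormedModule.Class R_AbsRing X
        (NormedModuleAux.class R_AbsRing (realification_aux X))
        (realification_normed X))
      (CompleteSpace.Mixin X lim (@complete_cauchy X) (@close_lim X)))
    X.

Lemma is_linear_realification (X Y : CompleteNormedModule C_AbsRing)
    (L : X -> Y) :
  is_linear L -> @is_linear R_AbsRing (realification X) (realification Y) L.
Proof.
intros HL; split.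
- exact (linear_plus L HL).
- intros r x; exact (linear_scal L HL (RtoC r) x).
- exact (linear_norm L HL).
Qed.

Lemma norm_scal_RtoC (X : NormedModule C_AbsRing) (r : R) (x : X) :
  norm (scal (RtoC r : C_AbsRing) x) = Rabs r * norm x.
Proof.
assert (le : forall s (y : X), norm (scal (RtoC s : C_AbsRing) y) <= Rabs s * norm y).
{ intros s y; rewrite <- Cmod_R; exact (norm_scal (RtoC s : C_AbsRing) y). }
apply Rle_antisym; [apply le|].
destruct (Req_dec r 0) as [->|r0].
{ rewrite Rabs_R0, Rmult_0_l; apply norm_ge_0. }
generalize (le (/ r) (scal (RtoC r : C_AbsRing) x)).
rewrite scal_assoc.
replace (mult (RtoC (/ r) : C_AbsRing) (RtoC r)) with (one : C_AbsRing).
2:{ change (RtoC 1 = Cmult (RtoC (/ r)) (RtoC r)).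
    rewrite <- RtoC_mult, Rinv_l; [reflexivity | exact r0]. }
rewrite scal_one, Rabs_inv; intros H.
assert (p := Rabs_pos_lt r r0).
apply (Rmult_le_compat_l (Rabs r)) in H; [|lra].
rewrite <- Rmult_assoc, Rinv_r, Rmult_1_l in H; lra.
Qed.

Lemma norm_minus_sym (K : AbsRing) (V : NormedModule K) (x y : V) :
  norm (minus x y) = norm (minus y x).
Proof. rewrite <- (opp_minus y x); apply norm_opp. Qed.

Lemma minus_plus_cancel (G : AbelianGroup) (x y : G) : plus x (minus y x) = y.
Proof.
change (plus x (plus y (opp x)) = y).
rewrite (plus_comm y), plus_assoc, plus_opp_r; apply plus_zero_l.
Qed.

Lemma minus_plus_l (G : AbelianGroup) (x y : G) : minus (plus x y) x = y.
Proof.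
change (plus (plus x y) (opp x) = y).
rewrite (plus_comm x), <- plus_assoc, plus_opp_r; apply plus_zero_r.
Qed.

Lemma norm_le_minus (K : AbsRing) (V : NormedModule K) (x y : V) :
  norm y <= norm x + norm (minus y x).
Proof. rewrite <- (minus_plus_cancel V x y) at 1; apply norm_triangle. Qed.

Lemma norm_minus_triangle (K : AbsRing) (V : NormedModule K) (y x z : V) :
  norm (minus x z) <= norm (minus x y) + norm (minus y z).
Proof. rewrite (minus_trans y); apply norm_triangle. Qed.

Lemma norm_minus_diag (K : AbsRing) (V : NormedModule K) (x : V) :
  norm (minus x x) = 0.
Proof. exact (eq_trans (f_equal norm (minus_eq_zero x)) norm_zero). Qed.

Lemma norm_minus_le (K : AbsRing) (V : NormedModule K) (x y : V) :
  norm (minus x y) <= norm x + norm y.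
Proof. rewrite <- (norm_opp y); exact (norm_triangle x (opp y)). Qed.

Lemma norm_linear_minus (K : AbsRing) (U V : NormedModule K) (L : U -> V)
    (x y : U) :
  is_linear L -> norm (minus (L x) (L y)) = norm (L (minus x y)).
Proof. intros HL; exact (f_equal norm (eq_sym (linear_minus L x y HL))). Qed.

Lemma filterlim_at_right_0_norm (K : AbsRing) (V : NormedModule K)
    (f : R -> V) (y : V) :
  filterlim f (at_right 0) (locally y) <->
  forall e, 0 < e -> exists d, 0 < d /\
    forall h, 0 < h < d -> norm (minus (f h) y) < e.
Proof.
rewrite (filterlim_locally_ball_norm f y); split.
- intros H e e0; destruct (H (mkposreal e e0)) as [d Hd].
  exists d; split; [apply cond_pos|]; intros h Hh; apply (Hd h); [|lra].
  change (Rabs (h - 0) < d); rewrite Rabs_pos_eq; lra.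
- intros H e; destruct (H e (cond_pos e)) as [d [d0 Hd]].
  exists (mkposreal d d0); intros h Hh h0; apply Hd; split; [exact h0|].
  change (Rabs (h - 0) < d) in Hh; rewrite Rabs_pos_eq in Hh; lra.
Qed.

(** The centres form a Cauchy sequence, since [r] takes arbitrarily small values, and
    their limit stays in every closed ball. *)
Lemma complete_nested (K : AbsRing) (V : CompleteNormedModule K)
    (x : nat -> V) (r : nat -> R) :
  (forall e, 0 < e -> exists k, r k < e) ->
  (forall k m, (k <= m)%nat -> norm (minus (x m) (x k)) <= r k) ->
  exists l, forall k, norm (minus l (x k)) <= r k.
Proof.
intros r0 Hx; set (F := filtermap x eventually).
assert (PF : ProperFilter F).
{ apply filtermap_proper_filter, eventually_filter. }
assert (cF : cauchy F).
{ intros e; destruct (r0 e (cond_pos e)) as [k Hk]; exists (x k), k.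
  intros m Hm; apply (@norm_compat1 K V).
  apply Rle_lt_trans with (2 := Hk); auto. }
assert (Hl : filterlim x eventually (locally (lim F))).
{ apply filterlim_locally; intros e; exact (complete_cauchy F PF cF e). }
exists (lim F); intros k; apply Rnot_lt_le; intros Hk.
destruct (proj1 (filterlim_locally_ball_norm x (lim F)) Hl
  (mkposreal _ (proj2 (Rlt_0_minus _ _) Hk))) as [N HN].
set (m := Nat.max k N) in *.
assert (H1 : norm (minus (x m) (lim F)) < norm (minus (lim F) (x k)) - r k)
  by exact (HN m (Nat.le_max_r _ _)).
assert (H2 := Hx k m (Nat.le_max_l _ _)).
assert (H3 : norm (minus (lim F) (x k)) <=
  norm (minus (x m) (lim F)) + norm (minus (x m) (x k))).
{ apply Rle_trans with (1 := norm_minus_triangle K V (x m) (lim F) (x k)).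
  apply Rplus_le_compat_r; right; exact (norm_minus_sym K V _ _). }
lra.
Qed.

(** * The uniform boundedness principle *)

(** A linear family bounded by [K] on a ball is bounded by [2 * K] on vectors of
    length [r], because such a vector is a difference of two points of the ball; by
    homogeneity it would be uniformly bounded. *)
Lemma unbounded_large_in_ball (X Y : NormedModule C_AbsRing) (B : nat -> X -> Y)
    (B_linear : forall n, is_linear (B n)) :
  ~ (exists M, forall n x, norm (B n x) <= M * norm x) ->
  forall (K : R) (x : X) (r : R), 0 < r ->
  exists n (z : X), norm (minus z x) <= r /\ K < norm (B n z).
Proof.
intros unbounded K x r r0; apply NNPP; intros none.
assert (HK : forall n (z : X), norm (minus z x) <= r -> norm (B n z) <= K).
{ intros n z Hz; apply Rnot_lt_le; intros H; apply none; exists n, z; auto. }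
apply unbounded; exists (2 * K / r); intros n w.
destruct (Req_dec (norm w) 0) as [w0|w0].
{ apply norm_eq_zero in w0; rewrite w0, (linear_zero _ (B_linear n)), !norm_zero; lra. }
assert (w1 : 0 < norm w) by (generalize (norm_ge_0 w); lra).
set (c := r / norm w).
assert (c0 : 0 < c) by (apply Rdiv_lt_0_compat; lra).
assert (Hxx : norm (minus x x) <= r) by (rewrite norm_minus_diag; lra).
assert (Hz : minus (plus x (scal (RtoC c : C_AbsRing) w)) x =
  scal (RtoC c : C_AbsRing) w).
{ exact (minus_plus_l X x _). }
assert (H1 := HK n x Hxx).
assert (H2 : norm (B n (plus x (scal (RtoC c : C_AbsRing) w))) <= K).
{ apply HK; rewrite Hz, norm_scal_RtoC, Rabs_pos_eq; [|lra].
  unfold c; right; field; lra. }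
assert (H3 := norm_minus_le _ _ (B n (plus x (scal (RtoC c : C_AbsRing) w))) (B n x)).
rewrite (norm_linear_minus _ _ _ _ _ _ (B_linear n)), Hz in H3.
rewrite (linear_scal _ (B_linear n)) in H3.
rewrite norm_scal_RtoC, Rabs_pos_eq in H3; [|lra].
replace (2 * K / r * norm w) with (/ c * (2 * K)) by (unfold c; field; lra).
apply (Rmult_le_reg_l c); [exact c0|].
rewrite <- Rmult_assoc, Rinv_r; lra.
Qed.

(** If the family were not uniformly bounded, one could shrink a ball repeatedly so
    that on the [k]-th ball some operator of the family exceeds [k] in norm. The point
    common to all the balls would contradict pointwise boundedness. *)
Lemma uniform_boundedness (X : CompleteNormedModule C_AbsRing)
    (Y : NormedModule C_AbsRing) (B : nat -> X -> Y) :
  (forall n, is_linear (B n)) ->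
  (forall x, exists M, forall n, norm (B n x) <= M) ->
  exists M, forall n x, norm (B n x) <= M * norm x.
Proof.
intros B_linear pointwise; apply NNPP; intros unbounded.
assert (step : forall (k : nat) (p : X * R), exists q : X * R, 0 < snd p ->
  0 < snd q /\ snd q <= / INR (S k) /\
  norm (minus (fst q) (fst p)) + snd q <= snd p /\
  exists n, forall y, norm (minus y (fst q)) <= snd q -> INR k < norm (B n y)).
{ intros k [x r]; cbn [fst snd].
  destruct (Rlt_dec 0 r) as [r0|nr]; [|exists (x, r); intros; contradiction].
  destruct (unbounded_large_in_ball X Y B B_linear unbounded (INR k) x (r / 2))
    as [n [z [Hz1 Hz2]]]; [lra|].
  destruct (linear_norm _ (B_linear n)) as [L [L0 HL]].
  (* A radius [g] keeps [B n y] within half of the gap between [norm (B n z)] and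
     [INR k]. *)
  set (g := (norm (B n z) - INR k) / (2 * L)).
  assert (g0 : 0 < g) by (apply Rdiv_lt_0_compat; lra).
  assert (k0 : 0 < / INR (S k)) by (apply Rinv_0_lt_compat, lt_0_INR; lia).
  exists (z, Rmin (r / 2) (Rmin (/ INR (S k)) g)); intros _; cbn [fst snd].
  assert (Hm1 := Rmin_l (r / 2) (Rmin (/ INR (S k)) g)).
  assert (Hm2 := Rmin_r (r / 2) (Rmin (/ INR (S k)) g)).
  assert (Hm3 := Rmin_l (/ INR (S k)) g).
  assert (Hm4 := Rmin_r (/ INR (S k)) g).
  repeat split; [repeat apply Rmin_glb_lt; lra | lra | |].
  { apply Rle_trans with (1 := Rplus_le_compat_r _ _ _ Hz1); lra. }
  exists n; intros y Hy.
  assert (H1 := norm_le_minus _ _ (B n y) (B n z)).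
  rewrite (norm_linear_minus _ _ _ _ _ _ (B_linear n)) in H1.
  assert (H3 := HL (minus z y)).
  assert (H2 : L * norm (minus z y) <= L * g).
  { apply Rmult_le_compat_l; [lra|].
    apply Rle_trans with (1 := Req_le _ _ (norm_minus_sym _ X z y)).
    apply Rle_trans with (1 := Hy); lra. }
  replace (L * g) with ((norm (B n z) - INR k) / 2) in H2 by (unfold g; field; lra).
  lra. }
set (next k p := proj1_sig (constructive_indefinite_description _ (step k p))).
assert (next_spec := fun k p =>
  proj2_sig (constructive_indefinite_description _ (step k p))).
change (forall k p, 0 < snd p -> 0 < snd (next k p) /\ snd (next k p) <= / INR (S k) /\
  norm (minus (fst (next k p)) (fst p)) + snd (next k p) <= snd p /\
  exists n, forall y, norm (minus y (fst (next k p))) <= snd (next k p) ->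
    INR k < norm (B n y)) in next_spec.
clearbody next.
set (p := nat_rect (fun _ => (X * R)%type) (zero, 1) next).
assert (p0 : forall k, 0 < snd (p k)).
{ induction k; [simpl; lra | apply (next_spec k (p k)), IHk]. }
assert (nested : forall k m, (k <= m)%nat ->
  norm (minus (fst (p m)) (fst (p k))) + snd (p m) <= snd (p k)).
{ intros k m Hkm; induction Hkm as [|m Hkm IH].
  - apply Rle_trans with (0 + snd (p k)); [|lra].
    apply Rplus_le_compat_r; right; exact (norm_minus_diag _ X _).
  - destruct (next_spec m (p m) (p0 m)) as [_ [_ [H _]]].
    change (next m (p m)) with (p (S m)) in H.
    assert (H1 : norm (minus (fst (p (S m))) (fst (p k))) <=
      norm (minus (fst (p (S m))) (fst (p m))) + norm (minus (fst (p m)) (fst (p k))))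
      by exact (norm_minus_triangle _ X _ _ _).
    lra. }
destruct (complete_nested _ X (fun k => fst (p k)) (fun k => snd (p k)))
  as [l Hl].
- intros e e0; destruct (archimed_cor1 e e0) as [[|k] [Hk k0]]; [lia|].
  exists (S k); apply Rle_lt_trans with (2 := Hk).
  apply (next_spec k (p k) (p0 k)).
- intros k m Hkm; generalize (nested k m Hkm) (p0 m); lra.
- destruct (pointwise l) as [M HM].
  destruct (INR_archimed 1 M) as [k Hk]; [lra|].
  destruct (next_spec k (p k) (p0 k)) as [_ [_ [_ [n Hn]]]].
  generalize (Hn l (Hl (S k))) (HM n); lra.
Qed.

(** * Strong continuity and local boundedness of semigroups *)

Lemma semigroup_cont_norm (X : Hilbert) (T : R -> X -> X) (x : X) (e : R) :
  C0_semigroup T -> 0 < e ->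
  exists d, 0 < d /\ forall h, 0 <= h < d -> norm (minus (T h x) x) < e.
Proof.
intros HT e0.
destruct (proj1 (filterlim_at_right_0_norm _ X (fun t => T t x) x)
  (semigroup_cont T HT x) e e0) as [d [d0 Hd]].
exists d; split; [exact d0|]; intros h Hh.
destruct (Req_dec h 0) as [->|h0]; [|apply Hd; lra].
rewrite (semigroup_zero T HT).
apply Rle_lt_trans with (2 := e0); right; exact (norm_minus_diag _ X x).
Qed.

(** Otherwise there are times tending to [0] along which the operators are unbounded,
    although along these times every orbit converges: this contradicts the uniform
    boundedness principle. *)
Lemma semigroup_bounded_near_zero (X : Hilbert) (T : R -> X -> X) :
  C0_semigroup T ->
  exists d M, 0 < d /\ 1 <= M /\
    forall t x, 0 <= t <= d -> norm (T t x) <= M * norm x.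
Proof.
intros HT; apply NNPP; intros unbounded.
assert (bad : forall n : nat, exists t, 0 <= t <= / INR (S n) /\
  exists x, INR (S n) * norm x < norm (T t x)).
{ intros n; apply NNPP; intros good; apply unbounded.
  exists (/ INR (S n)), (INR (S n)).
  split; [apply Rinv_0_lt_compat, lt_0_INR; lia|].
  split; [apply (le_INR 1); lia|].
  intros t x Ht; apply Rnot_lt_le; intros H; apply good; exists t; eauto. }
set (t n := proj1_sig (constructive_indefinite_description _ (bad n))).
assert (Ht := fun n => proj2_sig (constructive_indefinite_description _ (bad n))).
change (forall n, 0 <= t n <= / INR (S n) /\
  exists x, INR (S n) * norm x < norm (T (t n) x)) in Ht.
clearbody t.
destruct (uniform_boundedness X X (fun n => T (t n))) as [M HM].
- intros n; apply (semigroup_linear T HT), Ht.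
- intros x; destruct (filterlim_bounded (fun n => T (t n) x)) as [M HM];
    [exists x | exists M; exact HM].
  apply (filterlim_locally_ball_norm (U := X)); intros e.
  destruct (semigroup_cont_norm X T x e HT (cond_pos e)) as [d [d0 Hd]].
  destruct (archimed_cor1 d d0) as [N [HN N0]].
  exists N; intros n Hn; apply Hd; split; [apply Ht|].
  apply Rle_lt_trans with (1 := proj2 (proj1 (Ht n))).
  apply Rle_lt_trans with (2 := HN), Rinv_le_contravar;
    [apply lt_0_INR; lia | apply le_INR; lia].
- destruct (INR_archimed 1 M) as [n Hn]; [lra|].
  destruct (Ht n) as [_ [x Hx]].
  apply (Rlt_irrefl (norm (T (t n) x))).
  apply Rle_lt_trans with (1 := HM n x).
  apply Rle_lt_trans with (2 := Hx), Rmult_le_compat_r;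
    [exact (norm_ge_0 (x : X)) | rewrite S_INR; lra].
Qed.

Lemma semigroup_bounded_on (X : Hilbert) (T : R -> X -> X) (a : R) :
  C0_semigroup T ->
  exists M, 0 < M /\ forall t x, 0 <= t <= a -> norm (T t x) <= M * norm x.
Proof.
intros HT.
destruct (semigroup_bounded_near_zero X T HT) as [d [M [d0 [M1 HM]]]].
assert (H : forall n t x, 0 <= t <= INR (S n) * d ->
  norm (T t x) <= M ^ S n * norm x).
{ induction n as [|n IH]; intros t x Ht.
  - simpl (M ^ 1); rewrite Rmult_1_r; apply HM; simpl in Ht; lra.
  - rewrite S_INR in Ht.
    assert (Mn : 0 < M ^ S n) by (apply pow_lt; lra).
    destruct (Rle_dec t d) as [td|td].
    + apply Rle_trans with (1 := HM t x ltac:(lra)).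
      apply Rmult_le_compat_r; [exact (norm_ge_0 (x : X))|].
      rewrite <- (pow_1 M) at 1; apply Rle_pow; [lra | lia].
    + replace t with (d + (t - d)) by ring.
      rewrite (semigroup_plus T HT); [|lra..].
      apply Rle_trans with (1 := HM d _ ltac:(lra)).
      change (M ^ S (S n)) with (M * M ^ S n); rewrite Rmult_assoc.
      apply Rmult_le_compat_l; [lra|]; apply IH; lra. }
destruct (INR_archimed d a d0) as [n Hn].
exists (M ^ S n); split; [apply pow_lt; lra|].
intros t x Ht; apply H; rewrite S_INR; lra.
Qed.

(** Two-sided, hence stronger than the right continuity built into the definition:
    [T t x - T s x = T s (T (t - s) x - x)] and [T s] is bounded uniformly in [s]. *)
Lemma semigroup_uniform_cont (X : Hilbert) (T : R -> X -> X) (x : X) (a e : R) :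
  C0_semigroup T -> 0 < e ->
  exists d, 0 < d /\ forall s t, 0 <= s <= a -> 0 <= t <= a -> Rabs (t - s) < d ->
    norm (minus (T t x) (T s x)) < e.
Proof.
intros HT e0.
destruct (semigroup_bounded_on X T a HT) as [M [M0 HM]].
destruct (semigroup_cont_norm X T x (e / M) HT) as [d [d0 Hd]].
{ apply Rdiv_lt_0_compat; lra. }
assert (ordered : forall s t, 0 <= s <= a -> 0 <= t <= a -> 0 <= t - s < d ->
  norm (minus (T t x) (T s x)) < e).
{ intros s t Hs Ht Hst.
  replace t with (s + (t - s)) by ring.
  rewrite (semigroup_plus T HT); [|lra..].
  apply Rle_lt_trans with (M * norm (minus (T (t - s) x) x)).
  - apply Rle_trans with (norm (T s (minus (T (t - s) x) x))); [|apply HM; lra].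
    right; apply (norm_linear_minus _ X X); apply (semigroup_linear T HT); lra.
  - replace e with (M * (e / M)) by (field; lra).
    apply Rmult_lt_compat_l; [lra|]; apply Hd; lra. }
exists d; split; [exact d0|]; intros s t Hs Ht Hst.
destruct (Rle_dec s t) as [H|H].
- apply ordered; [lra..|]; rewrite Rabs_pos_eq in Hst; lra.
- apply Rle_lt_trans with (1 := Req_le _ _ (norm_minus_sym _ X _ _)).
  apply ordered; [lra..|].
  rewrite Rabs_minus_sym, Rabs_pos_eq in Hst; lra.
Qed.

(** * Generators *)

(** The defining limit without division, as a first-order expansion of the orbit at
    time zero. *)
Lemma is_generator_norm (X : Hilbert) (A : Operator X X) (T : R -> X -> X) :
  is_generator A T -> forall x y, (dom A x /\ A x = y) <->
  forall e, 0 < e -> exists d, 0 < d /\ forall h, 0 < h < d ->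
    norm (minus (minus (T h x) x) (scal (RtoC h : C_AbsRing) y)) <= e * h.
Proof.
intros HA x y; rewrite (HA x y), (filterlim_at_right_0_norm _ X).
assert (scaled : forall h, 0 < h ->
  norm (minus (minus (T h x) x) (scal (RtoC h : C_AbsRing) y)) =
  h * norm (minus (scal (RtoC (/ h) : C_AbsRing) (minus (T h x) x)) y)).
{ intros h h0.
  set (q := scal (RtoC (/ h) : C_AbsRing) (minus (T h x) x)).
  transitivity (Rabs h * norm (minus q y)); [|rewrite Rabs_pos_eq; lra].
  refine (eq_trans _ (norm_scal_RtoC X h _)); unfold q.
  f_equal.
  refine (eq_trans _ (eq_sym (scal_minus_distr_l (V := X) _ _ _))).
  f_equal.
  refine (eq_trans _ (eq_sym (scal_assoc (V := X) _ _ _))).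
  replace (mult (RtoC h : C_AbsRing) (RtoC (/ h))) with (one : C_AbsRing).
  - exact (eq_sym (scal_one (V := X) _)).
  - change (RtoC 1 = Cmult (RtoC h) (RtoC (/ h))).
    rewrite <- RtoC_mult, Rinv_r; [reflexivity | lra]. }
split; intros H e e0.
- destruct (H e e0) as [d [d0 Hd]]; exists d; split; [exact d0|]; intros h Hh.
  apply Rle_trans with (1 := Req_le _ _ (scaled h (proj1 Hh))).
  rewrite Rmult_comm; apply Rmult_le_compat_r; [lra|].
  left; apply Hd, Hh.
- destruct (H (e / 2)) as [d [d0 Hd]]; [lra|].
  exists d; split; [exact d0|]; intros h Hh.
  apply (Rmult_lt_reg_l h); [lra|].
  apply Rle_lt_trans with (1 := Req_le _ _ (eq_sym (scaled h (proj1 Hh)))).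
  apply Rle_lt_trans with (1 := Hd h Hh); nra.
Qed.

(** The bounded operator [T s] commutes with the other [T t], hence with the difference
    quotients at [0] and with their limit. *)
Lemma generator_commutes (X : Hilbert) (A : Operator X X) (T : R -> X -> X)
    (x : X) (s : R) :
  C0_semigroup T -> is_generator A T -> 0 <= s -> dom A x ->
  dom A (T s x) /\ A (T s x) = T s (A x).
Proof.
intros HT HA s0 Hx; apply (HA (T s x)).
assert (Hlim := proj1 (HA x (A x)) (conj Hx eq_refl)).
assert (Ts := semigroup_linear T HT s s0).
apply (filterlim_ext_loc (F := at_right 0)
  (fun t => T s (scal (RtoC (/ t) : C_AbsRing) (minus (T t x) x)))).
- exists (mkposreal 1 Rlt_0_1); intros t _ t0.
  refine (eq_trans (linear_scal (T s) Ts _ _) _); f_equal.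
  refine (eq_trans (linear_minus (T s) _ _ Ts) _); f_equal.
  rewrite <- !(semigroup_plus T HT) by lra; f_equal; ring.
- apply (filterlim_comp _ _ _ _ (T s) _ _ _ Hlim).
  exact (linear_cont (T s) (A x) Ts).
Qed.

(** * Density of the domain of a generator *)

(** Linear maps commute with Riemann sums, and continuity carries this to the limit. *)
Lemma is_RInt_linear (U V : NormedModule R_AbsRing) (L : U -> V) (f : R -> U)
    (a b : R) (I : U) :
  is_linear L -> is_RInt f a b I -> is_RInt (fun s => L (f s)) a b (L I).
Proof.
intros HL Hf.
apply (filterlim_ext (F := Riemann_fine a b)
  (fun ptd => L (scal (sign (b - a)) (Riemann_sum f ptd)))).
- intros ptd; refine (eq_trans (linear_scal L HL _ _) _); f_equal.
  apply (SF_cons_ind (fun ptd => L (Riemann_sum f ptd) =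
    Riemann_sum (fun s => L (f s)) ptd)).
  + intros x0; exact (linear_zero L HL).
  + intros h s IH; rewrite !Riemann_sum_cons, <- IH.
    refine (eq_trans (linear_plus L HL _ _) _); f_equal.
    exact (linear_scal L HL _ _).
- apply (filterlim_comp _ _ _ _ L _ _ _ Hf); exact (linear_cont L I HL).
Qed.

Lemma is_derive_right_increment (V : NormedModule R_AbsRing) (g : R -> V) (l : V) :
  is_derive g 0 l ->
  forall e, 0 < e -> exists d, 0 < d /\ forall h, 0 < h < d ->
    norm (minus (minus (g h) (g 0)) (scal h l)) <= e * h.
Proof.
intros [_ Hg] e e0.
destruct (Hg 0 (fun P HP => HP) (mkposreal e e0)) as [d Hd].
exists d; split; [apply cond_pos|]; intros h Hh.
assert (H : ball 0 d h).
{ change (Rabs (h - 0) < d); rewrite Rabs_pos_eq; lra. }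
assert (K : norm (minus (minus (g h) (g 0)) (scal (h - 0) l)) <= e * Rabs (h - 0))
  by exact (Hd h H).
rewrite Rminus_0_r, Rabs_pos_eq in K by lra; exact K.
Qed.

(** Extending the orbit evenly to negative times makes it continuous on the whole
    line, as differentiating its integral at [0] requires. *)
Lemma orbit_continuous (X : Hilbert) (T : R -> X -> X) (x : X) :
  C0_semigroup T -> forall z,
  @continuous R_UniformSpace (realification X) (fun s => T (Rabs s) x) z.
Proof.
intros HT z.
apply (filterlim_locally (U := X)); intros e.
destruct (semigroup_uniform_cont X T x (Rabs z + 1) e HT (cond_pos e))
  as [d [d0 Hd]].
exists (mkposreal _ (Rmin_pos _ _ d0 Rlt_0_1)); intros s Hs.
change (Rabs (s - z) < Rmin d 1) in Hs.
assert (Hd1 := Rmin_l d 1); assert (Hd2 := Rmin_r d 1).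
assert (Hsz := Rabs_triang_inv2 s z).
assert (Hle := Rle_abs (Rabs s - Rabs z)).
apply (@norm_compat1 C_AbsRing X); apply Hd;
  generalize (Rabs_pos s) (Rabs_pos z); lra.
Qed.

(** With [Y a] the integral of the orbit [u] over [[0, a]], the semigroup law gives
    [T h (Y a)] as the integral of [u] over [[h, a + h]], whose derivative at [h = 0] is
    [u a - u 0]. Hence [Y a] is in the domain, and [Y a / a] tends to [u 0 = x]. *)
Lemma generator_dom_dense (X : Hilbert) (A : Operator X X) (T : R -> X -> X)
    (x : X) (e : R) :
  C0_semigroup T -> is_generator A T -> 0 < e ->
  exists y, dom A y /\ norm (minus y x) <= e.
Proof.
intros HT HA e0.
set (V := realification X).
set (u := (fun s => T (Rabs s) x) : R -> V).
assert (u_cont : forall z, continuous u z) by exact (orbit_continuous X T x HT).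
assert (u_int : forall a b, ex_RInt u a b).
{ intros a b; apply ex_RInt_continuous; intros; apply u_cont. }
assert (I_int : forall a b, is_RInt u a b (RInt u a b)).
{ intros a b; apply RInt_correct, u_int. }
assert (u0 : u 0 = x).
{ unfold u; rewrite Rabs_R0; apply (semigroup_zero T HT). }
assert (shift : forall a h, 0 <= a -> 0 <= h ->
  T h (RInt u 0 a) = RInt u h (a + h)).
{ intros a h a0 h0.
  assert (J1 := is_RInt_linear V V (T h) u 0 a _
    (is_linear_realification X X (T h) (semigroup_linear T HT h h0)) (I_int 0 a)).
  assert (J2 := I_int h (a + h)).
  replace h with (1 * 0 + h) in J2 at 1 by ring.
  replace (a + h) with (1 * a + h) in J2 at 1 by ring.
  apply is_RInt_comp_lin in J2.
  apply (is_RInt_ext _ (fun s => T h (u s) : V)) in J2.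
  - exact (eq_trans (eq_sym (is_RInt_unique _ _ _ _ J1)) (is_RInt_unique _ _ _ _ J2)).
  - intros s Hs; rewrite Rmin_left, Rmax_right in Hs by lra.
    refine (eq_trans (scal_one (V := V) _) _); unfold u.
    rewrite Rmult_1_l, !Rabs_pos_eq by lra; rewrite Rplus_comm.
    apply (semigroup_plus T HT); lra. }
assert (average : is_derive (fun h => RInt u 0 h) 0 (u 0)).
{ apply (is_derive_RInt u _ 0 0); [|apply u_cont].
  exists (mkposreal 1 Rlt_0_1); intros b _; apply I_int. }
destruct (is_derive_right_increment V _ _ average e e0) as [d [d0 Hd]].
set (a := d / 2); assert (a0 : 0 < a < d) by (unfold a; lra).
assert (Ya : dom A (RInt u 0 a : X)).
{ assert (D : is_derive (fun h => RInt u h (a + h)) 0 (minus (u a) (u 0))).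
  { assert (D := is_derive_RInt_bound_comp u (fun b c => RInt u b c)
      (fun h => h) (fun h => a + h) 1 1 0).
    replace (minus (u a) (u 0)) with
      (minus (scal 1 (u (a + 0))) (scal 1 (u 0))).
    - apply D; [|apply u_cont|apply u_cont| |].
      + exists (mkposreal 1 Rlt_0_1); intros b _; apply I_int.
      + exact (is_derive_id (K := R_AbsRing) 0).
      + auto_derive; [exact I | ring].
    - rewrite Rplus_0_r; f_equal; exact (scal_one (V := V) _). }
  apply (is_generator_norm X A T HA (RInt u 0 a : X) (minus (u a) (u 0) : V)).
  intros e' e'0; destruct (is_derive_right_increment V _ _ D e' e'0) as [d' [d'0 Hd']].
  exists d'; split; [exact d'0|]; intros h Hh.
  assert (K := Hd' h Hh); rewrite Rplus_0_r in K.
  rewrite <- (shift a h) in K by lra; exact K. }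
exists (scal (RtoC (/ a) : C_AbsRing) (RInt u 0 a : X)); split.
{ exact (dom_scal A _ _ Ya). }
assert (K := Hd a a0).
assert (Kx : norm (minus (RInt u 0 a) (scal a (x : V))) <= e * a).
{ rewrite <- u0; refine (Rle_trans _ _ _ _ K); right; f_equal; f_equal.
  rewrite RInt_point; exact (eq_sym (minus_zero_r (G := V) _)). }
apply (Rmult_le_reg_l a); [lra|]; rewrite (Rmult_comm a e).
refine (Rle_trans _ _ _ _ Kx); right.
set (y := RInt u 0 a : X).
transitivity (Rabs a *
  norm (minus (scal (RtoC (/ a) : C_AbsRing) y) x)).
{ rewrite Rabs_pos_eq by lra; reflexivity. }
refine (eq_trans (eq_sym (norm_scal_RtoC X a _)) _).
apply (f_equal (@norm C_AbsRing X)).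
refine (eq_trans (scal_minus_distr_l (V := X) _ _ _) _); f_equal.
refine (eq_trans (scal_assoc (V := X) _ _ _) _).
replace (mult (RtoC a : C_AbsRing) (RtoC (/ a))) with (one : C_AbsRing).
- exact (scal_one (V := X) _).
- change (RtoC 1 = Cmult (RtoC a) (RtoC (/ a))).
  rewrite <- RtoC_mult, Rinv_r; [reflexivity | lra].
Qed.

(** * Dissipative operators *)

Lemma Re_inner_plus (X : Hilbert) (x y z : X) :
  Re (inner (plus x y) z) = Re (inner x z) + Re (inner y z).
Proof. rewrite inner_plus_l; reflexivity. Qed.

Lemma Re_inner_scal (X : Hilbert) (r : R) (x z : X) :
  Re (inner (scal (RtoC r : C_AbsRing) x) z) = r * Re (inner x z).
Proof. rewrite inner_scal_l; unfold Re, Cmult, RtoC; simpl; ring. Qed.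

Lemma Re_inner_opp (X : Hilbert) (x z : X) :
  Re (inner (opp x) z) = - Re (inner x z).
Proof.
assert (H := Re_inner_plus X x (opp x) z).
assert (H0 := Re_inner_plus X zero zero z).
assert (E : plus x (opp x) = zero) by exact (plus_opp_r (G := X) x).
assert (E0 : plus (zero : X) zero = zero) by exact (plus_zero_l (G := X) zero).
rewrite E in H; rewrite E0 in H0; lra.
Qed.

Lemma Re_inner_minus (X : Hilbert) (x y z : X) :
  Re (inner (minus x y) z) = Re (inner x z) - Re (inner y z).
Proof.
refine (eq_trans (Re_inner_plus X x (opp y) z) _).
rewrite Re_inner_opp; ring.
Qed.

Lemma Re_inner_sym (X : Hilbert) (x y : X) : Re (inner x y) = Re (inner y x).
Proof. rewrite inner_conj; reflexivity. Qed.

Lemma Re_inner_diag (X : Hilbert) (x : X) : Re (inner x x) = norm x ^ 2.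
Proof. rewrite inner_norm; reflexivity. Qed.

(** The Cauchy-Schwarz inequality, from the positivity of the quadratic form
    [|a x - b y|^2] in the real coefficients [a] and [b]. *)
Lemma Re_inner_le (X : Hilbert) (x y : X) :
  Re (inner x y) <= norm x * norm y.
Proof.
assert (expand : forall a b : R,
  0 <= a ^ 2 * norm x ^ 2 - 2 * (a * b) * Re (inner x y) + b ^ 2 * norm y ^ 2).
{ intros a b.
  set (z := minus (scal (RtoC a : C_AbsRing) x) (scal (RtoC b : C_AbsRing) y)).
  replace (a ^ 2 * norm x ^ 2 - 2 * (a * b) * Re (inner x y) + b ^ 2 * norm y ^ 2)
    with (Re (inner z z)); [rewrite Re_inner_diag; apply pow2_ge_0|].
  unfold z at 1; rewrite Re_inner_minus, !Re_inner_scal.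
  rewrite (Re_inner_sym X x z), (Re_inner_sym X y z).
  unfold z; rewrite !Re_inner_minus, !Re_inner_scal, !Re_inner_diag.
  rewrite (Re_inner_sym X y x); ring. }
assert (x0 : 0 <= norm x) by exact (norm_ge_0 (x : X)).
assert (y0 : 0 <= norm y) by exact (norm_ge_0 (y : X)).
destruct (Req_dec (norm x * norm y) 0) as [H0|H0].
- (* One vector vanishes, so the form is affine in its coefficient; these two choices
     cover the two cases and force the real part to be [0]. *)
  assert (H := expand (1 + norm y ^ 2) (Re (inner x y))).
  assert (H' := expand (Re (inner x y)) (1 + norm x ^ 2)).
  rewrite H0.
  destruct (Rmult_integral _ _ H0) as [Hx|Hy]; [rewrite Hx in * | rewrite Hy in *]; nra.
- assert (H := expand (norm y) (norm x)).
  assert (p : 0 < norm x * norm y) by nra.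
  apply (Rmult_le_reg_l _ _ _ p); nra.
Qed.

(** Contractivity and Cauchy-Schwarz give [Re (T h x - x | x) <= 0]; the first-order
    term of this quantity in [h] is [h * Re (A x | x)]. *)
Lemma contraction_generator_dissipative (X : Hilbert) (A : Operator X X)
    (T : R -> X -> X) (x : X) :
  contractive T -> is_generator A T -> dom A x -> Re (inner (A x) x) <= 0.
Proof.
intros HT HA Hx; apply Rnot_lt_le; intros pos.
assert (x0 : 0 <= norm x) by exact (norm_ge_0 (x : X)).
set (e := Re (inner (A x) x) / (2 * (norm x + 1))).
assert (e0 : 0 < e) by (apply Rdiv_lt_0_compat; lra).
destruct (proj1 (is_generator_norm X A T HA x (A x)) (conj Hx eq_refl) e e0)
  as [d [d0 Hd]].
assert (Hh := Hd (d / 2) ltac:(lra)).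
set (h := d / 2) in *; assert (h0 : 0 < h) by (unfold h; lra).
set (r := minus (minus (T h x) x) (scal (RtoC h : C_AbsRing) (A x))) in *.
assert (Hr : - (norm r * norm x) <= Re (inner r x)).
{ assert (H := Re_inner_le X (opp r) x).
  rewrite Re_inner_opp in H.
  assert (E : norm (opp r) = norm r) by exact (norm_opp (V := X) r).
  rewrite E in H; lra. }
unfold r in Hr at 2; rewrite !Re_inner_minus, Re_inner_scal, Re_inner_diag in Hr.
assert (H1 := Re_inner_le X (T h x) x).
assert (H2 := HT h x (Rlt_le _ _ h0)).
assert (H3 : norm (T h x) * norm x <= norm x * norm x) by nra.
assert (H4 : norm r * norm x <= e * h * norm x) by (apply Rmult_le_compat_r; assumption).
assert (H5 : h * Re (inner (A x) x) = h * (2 * (norm x + 1) * e))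
  by (unfold e; field; lra).
nra.
Qed.

(** Test [y - h A y] against [y] and apply Cauchy-Schwarz. *)
Lemma dissipative_resolvent (X : Hilbert) (A : Operator X X) (eps h : R) (y : X) :
  Re (inner (A y) y) <= - eps * norm y ^ 2 -> 0 <= h ->
  (1 + eps * h) * norm y <= norm (minus y (scal (RtoC h : C_AbsRing) (A y))).
Proof.
intros Hy h0.
assert (H := Re_inner_le X (minus y (scal (RtoC h : C_AbsRing) (A y))) y).
rewrite Re_inner_minus, Re_inner_scal, Re_inner_diag in H.
assert (y0 : 0 <= norm y) by exact (norm_ge_0 (y : X)).
assert (z0 : 0 <= norm (minus y (scal (RtoC h : C_AbsRing) (A y))))
  by exact (norm_ge_0 (V := X) _).
destruct (Req_dec (norm y) 0) as [E|E]; [rewrite E; lra|].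
apply (Rmult_le_reg_r (norm y)); [lra | nra].
Qed.

(** * Decay of semigroups with strictly dissipative generator *)

(** Apply [dissipative_resolvent] to [y = T (s + h) x]. Since [A] commutes with the
    semigroup, [y - h A y = T s w] with [w = T h x - h T h (A x)], and
    [w - x = (T h x - x - h A x) + h (A x - T h (A x))] is [o(h)]. The bound on [T s] for
    [s] in [[0, t]] makes the error uniform. *)
Lemma semigroup_step (X : Hilbert) (A : Operator X X) (T : R -> X -> X)
    (eps : R) (x : X) (t e : R) :
  C0_semigroup T -> is_generator A T ->
  (forall x, dom A x -> Re (inner (A x) x) <= - eps * norm x ^ 2) ->
  dom A x -> 0 < e ->
  exists d, 0 < d /\ forall s h, 0 <= s <= t -> 0 < h < d ->
    (1 + eps * h) * norm (T (s + h) x) <= norm (T s x) + e * h.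
Proof.
intros HT HA diss Hx e0.
destruct (semigroup_bounded_on X T t HT) as [M [M0 HM]].
set (e' := e / (2 * M)); assert (e'0 : 0 < e') by (apply Rdiv_lt_0_compat; lra).
destruct (proj1 (is_generator_norm X A T HA x (A x)) (conj Hx eq_refl) e' e'0)
  as [d1 [d10 Hd1]].
destruct (semigroup_cont_norm X T (A x) e' HT e'0) as [d2 [d20 Hd2]].
exists (Rmin d1 d2); split; [apply Rmin_pos; assumption|]; intros s h Hs Hh.
assert (Hm1 := Rmin_l d1 d2); assert (Hm2 := Rmin_r d1 d2).
assert (Ts := semigroup_linear T HT s (proj1 Hs)).
destruct (generator_commutes X A T x (s + h) HT HA ltac:(lra) Hx) as [Hy Ay].
apply Rle_trans with (1 := dissipative_resolvent X A eps h _ (diss _ Hy) ltac:(lra)).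
set (w := minus (T h x) (scal (RtoC h : C_AbsRing) (T h (A x)))).
assert (E : minus (T (s + h) x) (scal (RtoC h : C_AbsRing) (A (T (s + h) x))) = T s w).
{ rewrite Ay, !(semigroup_plus T HT) by lra.
  refine (eq_sym (eq_trans (linear_minus (T s) _ _ Ts) _)).
  f_equal; exact (linear_scal (T s) Ts _ _). }
rewrite E.
assert (tri : norm (T s w) <= norm (T s x) + norm (minus (T s w) (T s x)))
  by exact (norm_le_minus _ X (T s x) (T s w)).
apply Rle_trans with (1 := tri), Rplus_le_compat_l.
apply Rle_trans with (norm (T s (minus w x)));
  [right; exact (norm_linear_minus _ X X (T s) w x Ts)|].
apply Rle_trans with (1 := HM s _ Hs).
replace (e * h) with (M * (e' * h + h * e')) by (unfold e'; field; lra).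
apply Rmult_le_compat_l; [lra|].
set (q := scal (RtoC h : C_AbsRing) (A x)).
set (q' := scal (RtoC h : C_AbsRing) (T h (A x))) in w.
assert (Hq : norm (minus q q') <= h * e').
{ apply Rle_trans with (Rabs h * norm (minus (A x) (T h (A x)))).
  - right; refine (eq_trans _ (norm_scal_RtoC X h _)).
    apply (f_equal (@norm C_AbsRing X)).
    exact (eq_sym (scal_minus_distr_l (V := X) _ _ _)).
  - rewrite Rabs_pos_eq by lra; apply Rmult_le_compat_l; [lra|].
    apply Rle_trans with (1 := Req_le _ _ (norm_minus_sym _ X _ _)).
    left; apply Hd2; lra. }
assert (Hp : norm (minus (minus (T h x) x) q) <= e' * h) by (apply Hd1; lra).
apply Rle_trans with (2 := Rplus_le_compat _ _ _ _ Hp Hq).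
refine (Rle_trans _ _ _ _ (norm_triangle (V := X) _ _)); right.
apply (f_equal (@norm C_AbsRing X)).
refine (eq_trans _ (minus_trans (G := X) q (minus (T h x) x) q')).
unfold w; generalize (T h x) q'; intros p v.
change (plus (plus p (opp v)) (opp x) = plus (plus p (opp x)) (opp v)).
rewrite <- !plus_assoc, (plus_comm (opp v)); reflexivity.
Qed.

(** Iterating [semigroup_step] over [n] steps of length [h = t / n] accumulates an
    error proportional to [t], which is arbitrarily small, and the contraction factor
    [(1 + eps * h)^(-n)] is at most [1 / (1 + eps * t)] by Bernoulli's inequality. *)
Lemma dissipative_decay_dom (X : Hilbert) (A : Operator X X) (T : R -> X -> X)
    (eps : R) (x : X) (t : R) :
  C0_semigroup T -> is_generator A T -> 0 < eps ->
  (forall x, dom A x -> Re (inner (A x) x) <= - eps * norm x ^ 2) ->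
  dom A x -> 0 < t ->
  (1 + eps * t) * norm (T t x) <= norm x.
Proof.
intros HT HA eps0 diss Hx t0.
apply le_epsilon; intros e e0.
assert (et : 0 < eps * t) by (apply Rmult_lt_0_compat; lra).
(* The accumulated error [e' * t], multiplied by [1 + eps * t], has to equal [e]. *)
set (e' := e / (t * (1 + eps * t))).
assert (e'0 : 0 < e') by (apply Rdiv_lt_0_compat; nra).
destruct (semigroup_step X A T eps x t e' HT HA diss Hx e'0) as [d [d0 Hd]].
destruct (INR_archimed d t d0) as [n Hn].
assert (n0 : 0 < INR n) by (apply Rnot_le_lt; intros H; nra).
set (h := t / INR n).
assert (nh : INR n * h = t) by (unfold h; field; lra).
assert (h0 : 0 < h < d).
{ split; [apply Rdiv_lt_0_compat; lra|].
  apply (Rmult_lt_reg_l (INR n)); lra. }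
set (q := / (1 + eps * h)).
assert (eh : 0 < eps * h) by (apply Rmult_lt_0_compat; lra).
assert (q1 : q * (1 + eps * h) = 1) by (unfold q; field; lra).
assert (q0 : 0 < q < 1) by nra.
assert (iter : forall k, (k <= n)%nat ->
  norm (T (INR k * h) x) <= q ^ k * norm x + INR k * (e' * h)).
{ induction k as [|k IH]; intros Hk.
  - simpl; rewrite Rmult_0_l, (semigroup_zero T HT); lra.
  - assert (IHk := IH ltac:(lia)); clear IH.
    assert (kn : INR k <= INR n) by (apply le_INR; lia).
    assert (k0 := pos_INR k).
    assert (st := Hd (INR k * h) h ltac:(nra) h0).
    rewrite S_INR, Rmult_plus_distr_r, Rmult_1_l.
    simpl (q ^ S k).
    set (N := norm (T (INR k * h + h) x)) in *.
    set (N' := norm (T (INR k * h) x)) in *.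
    assert (eh' : 0 < e' * h) by (apply Rmult_lt_0_compat; lra).
    assert (st' : N <= q * (N' + e' * h)).
    { apply (Rmult_le_reg_l (1 + eps * h)); [lra|].
      rewrite <- Rmult_assoc, (Rmult_comm _ q), q1; lra. }
    assert (st'' : q * (N' + e' * h) <=
      q * (q ^ k * norm x + INR k * (e' * h) + e' * h))
      by (apply Rmult_le_compat_l; lra).
    assert (0 <= INR k * (e' * h)) by (apply Rmult_le_pos; lra).
    nra. }
assert (Hfin := iter n (le_n n)); rewrite nh in Hfin.
rewrite <- Rmult_assoc, (Rmult_comm (INR n)), Rmult_assoc, nh in Hfin.
assert (bern := poly n (eps * h) eh).
replace (INR n * (eps * h)) with (eps * t) in bern by (rewrite <- nh; ring).
assert (qn : q ^ n * (1 + eps * h) ^ n = 1) by (rewrite <- Rpow_mult_distr, q1; apply pow1).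
assert (qn0 : 0 < q ^ n) by (apply pow_lt; lra).
assert (x0 : 0 <= norm x) by exact (norm_ge_0 (x : X)).
assert (qle : (1 + eps * t) * q ^ n <= 1) by nra.
apply Rle_trans with ((1 + eps * t) * (q ^ n * norm x + e' * t)).
{ apply Rmult_le_compat_l; lra. }
replace ((1 + eps * t) * (q ^ n * norm x + e' * t))
  with ((1 + eps * t) * q ^ n * norm x + e) by (unfold e'; field; lra).
nra.
Qed.

Lemma dissipative_decay (X : Hilbert) (A : Operator X X) (T : R -> X -> X)
    (eps : R) (x : X) (t : R) :
  C0_semigroup T -> is_generator A T -> 0 < eps ->
  (forall x, dom A x -> Re (inner (A x) x) <= - eps * norm x ^ 2) -> 0 < t ->
  (1 + eps * t) * norm (T t x) <= norm x.
Proof.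
intros HT HA eps0 diss t0.
apply le_epsilon; intros e e0.
assert (Tt := semigroup_linear T HT t (Rlt_le _ _ t0)).
destruct (linear_norm _ Tt) as [M [M0 HM]].
assert (et : 0 < eps * t) by (apply Rmult_lt_0_compat; lra).
set (c := (1 + eps * t) * M + 1).
assert (c0 : 0 < c) by (unfold c; nra).
destruct (generator_dom_dense X A T x (e / c) HT HA) as [y [Hy Hyx]].
{ apply Rdiv_lt_0_compat; lra. }
assert (H1 := dissipative_decay_dom X A T eps y t HT HA eps0 diss Hy t0).
assert (H2 : norm y <= norm x + norm (minus y x)) by exact (norm_le_minus _ X x y).
assert (H3 : norm (T t x) <= norm (T t y) + norm (minus (T t x) (T t y)))
  by exact (norm_le_minus _ X (T t y) (T t x)).
assert (H4 : norm (minus (T t x) (T t y)) <= M * norm (minus y x)).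
{ apply Rle_trans with (1 := Req_le _ _ (norm_minus_sym _ X _ _)).
  apply Rle_trans with (1 := Req_le _ _ (norm_linear_minus _ X X (T t) y x Tt)).
  apply HM. }
assert (H5 : c * norm (minus y x) <= e).
{ replace e with (c * (e / c)) by (field; lra).
  apply Rmult_le_compat_l; lra. }
unfold c in H5.
assert (H6 : (1 + eps * t) * norm (T t x) <=
  (1 + eps * t) * (norm (T t y) + M * norm (minus y x)))
  by (apply Rmult_le_compat_l; lra).
lra.
Qed.

(** The vector [zero] contributes the value [0] and [K] bounds the set, so that the
    supremum is finite and taking its real part is faithful. *)
Lemma op_norm_le (X Y : Hilbert) (B : X -> Y) (K : R) :
  B zero = zero -> (forall x, norm x <= 1 -> norm (B x) <= K) ->
  0 <= op_norm B <= K.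
Proof.
intros B0 HB; unfold op_norm.
set (E := fun r => exists x, norm x <= 1 /\ r = norm (B x)).
destruct (Lub_Rbar_correct E) as [ub least].
assert (H0 : Rbar_le 0 (Lub_Rbar E)).
{ apply (ub 0); exists zero; split.
  - apply Rle_trans with 0; [right; exact (norm_zero (V := X)) | lra].
  - exact (eq_sym (eq_trans (f_equal (@norm C_AbsRing Y) B0) norm_zero)). }
assert (HK : Rbar_le (Lub_Rbar E) K).
{ apply least; intros r [x [Hx ->]]; apply HB, Hx. }
destruct (Lub_Rbar E); simpl in *; [split; assumption | contradiction..].
Qed.

(** The orbit estimate bounds [op_norm (T t)] by [1 / (1 + eps * t)]. *)
Lemma strictly_dissipative_stable (X : Hilbert) (A : Operator X X)
    (T : R -> X -> X) :
  C0_semigroup T -> is_generator A T -> strictly_dissipative A ->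
  exponentially_stable T.
Proof.
intros HT HA [eps [eps0 diss]].
assert (bound : forall t, 0 < t -> 0 <= op_norm (T t) <= / (1 + eps * t)).
{ intros t t0; apply op_norm_le.
  - exact (linear_zero _ (semigroup_linear T HT t (Rlt_le _ _ t0))).
  - intros x Hx.
    assert (et : 0 < eps * t) by (apply Rmult_lt_0_compat; lra).
    apply (Rmult_le_reg_l (1 + eps * t)); [lra|].
    rewrite Rinv_r by lra; apply Rle_trans with (2 := Hx).
    apply (dissipative_decay X A T eps x t HT HA eps0 diss t0). }
apply is_lim_spec; intros e.
assert (e0 := cond_pos e).
assert (ee : 0 < eps * e) by (apply Rmult_lt_0_compat; lra).
exists (/ (eps * e)); intros t Ht.
assert (t0 : 0 < t) by (generalize (Rinv_0_lt_compat _ ee); lra).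
destruct (bound t t0) as [lower upper].
rewrite Rminus_0_r, Rabs_pos_eq by exact lower.
apply Rle_lt_trans with (1 := upper).
assert (large : 1 < eps * e * t).
{ rewrite <- (Rinv_r (eps * e)) by lra; apply Rmult_lt_compat_l; lra. }
apply (Rmult_lt_reg_l (1 + eps * t)); [nra|].
rewrite Rinv_r; nra.
Qed.

Lemma Re_inner_A_ext (H1 H2 : Hilbert) (A1 : Operator (prod_Hilbert H1 H2) H1)
    (A21 : Operator H1 H2) (S : H2 -> H2) (HS : is_linear S) (h : H1) :
  Re (inner (A_ext A1 A21 (h, S (A21 h))) ((h, S (A21 h)) : prod_Hilbert H1 H2)) =
  Re (inner (A_S A1 A21 HS h) h) + Re (inner (A21 h) (S (A21 h))).
Proof. reflexivity. Qed.

Theorem theorem3p9 (H1 H2 : Hilbert)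
    (H1_nonzero : exists x : H1, x <> zero)
    (H2_nonzero : exists x : H2, x <> zero)
    (A1 : Operator (prod_Hilbert H1 H2) H1)
    (A21 : Operator H1 H2)
    (S : H2 -> H2) (S_bounded : is_linear S) (S_coercive : coercive S)
    (A_ext_generates : generates_contraction_semigroup (A_ext A1 A21)) :
  ((exists eps : R, 0 < eps /\
      forall h : prod_Hilbert H1 H2, dom (A_ext A1 A21) h ->
        Re (inner (A_ext A1 A21 h) h) <= - eps * norm (fst h) ^ 2)
   \/ bounded_below A21) ->
  strictly_dissipative (A_S A1 A21 S_bounded) /\
  (forall T : R -> H1 -> H1,
     C0_semigroup T -> is_generator (A_S A1 A21 S_bounded) T ->
     exponentially_stable T).
Proof.
intros H.
assert (SD : strictly_dissipative (A_S A1 A21 S_bounded)).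
{ destruct S_coercive as [nu [nu0 Snu]].
  destruct H as [[eps [eps0 diss]] | [c [c0 below]]].
  - exists eps; split; [exact eps0|]; intros h [Hh21 Hh1].
    assert (Hext := diss (h, S (A21 h)) (conj Hh1 Hh21)).
    rewrite (Re_inner_A_ext H1 H2 A1 A21 S S_bounded h) in Hext.
    cbn [fst] in Hext.
    assert (Hnu := Snu (A21 h)).
    assert (0 <= nu * norm (A21 h) ^ 2)
      by (apply Rmult_le_pos; [lra | apply pow2_ge_0]).
    lra.
  - destruct A_ext_generates as [T [_ [T_contr T_gen]]].
    exists (nu * c ^ 2); split; [apply Rmult_lt_0_compat; nra|].
    intros h [Hh21 Hh1].
    assert (Hext := contraction_generator_dissipative _ _ T (h, S (A21 h))
      T_contr T_gen (conj Hh1 Hh21)).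
    rewrite (Re_inner_A_ext H1 H2 A1 A21 S S_bounded h) in Hext.
    assert (Hnu := Snu (A21 h)).
    assert (Hc : (c * norm h) ^ 2 <= norm (A21 h) ^ 2).
    { apply pow_incr; split; [|apply below, Hh21].
      apply Rmult_le_pos; [lra | exact (norm_ge_0 (h : H1))]. }
    assert (nu * (c * norm h) ^ 2 <= nu * norm (A21 h) ^ 2)
      by (apply Rmult_le_compat_l; lra).
    rewrite Rpow_mult_distr in *; lra. }
split; [exact SD|]; intros T HT HA.
exact (strictly_dissipative_stable H1 _ T HT HA SD).
Qed.
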